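(* Let $n\ge 1$ and let $\mathbf{A}\subset\mathbb{R}^{n\times n}$ be a compact set of real $n\times n$ matrices. Consider the linear switched system $$\dot x(t)=A(t)x(t),\qquad x\in\mathbb{R}^n,\quad A(\cdot):[0,\infty[\to\mathbf{A}\ \text{measurable}.$$ If the origin is a globally uniformly exponentially stable (GUES) equilibrium for this system, then the system admits a common Lyapunov function $V:\mathbb{R}^n\to\mathbb{R}^+$ which is a polynomial.
   Context: For a measurable switching function $A(\cdot):[0,\infty[\to\mathbf{A}$ and $x_0\in\mathbb{R}^n$, let $\phi^{A(\cdot)}_t(x_0)$ denote the value at time $t\ge 0$ of the (Carathéodory) solution of $\dot x(t)=A(t)x(t)$, $x(0)=x_0$. GUES: there exist constants $M,\lambda>0$ such that $\|\phi^{A(\cdot)}_t(x_0)\|\le M e^{-\lambda t}\|x_0\|$ for every $x_0\in\mathbb{R}^n$, every $t>0$ and every measurable $A(\cdot):[0,\infty[\to\mathbf{A}$. Common Lyapunov function (CLF): a continuous function $V:\mathbb{R}^n\to\mathbb{R}^+$ that is positive definite ($V(0)=0$ and $V(x)>0$ for all $x\ne 0$) and strictly decreasing along every nonconstant trajectory of the system (for every switching function). *)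

(* Defs.v *)
From HB Require Import structures.
From mathcomp Require Import all_boot all_order all_algebra.
From mathcomp Require Import all_classical all_reals all_analysis.
From mathcomp Require Import measurable_realfun.
(* Required but not imported: its notations clash with those of analysis. *)
From mathcomp Require mpoly.
Set Implicit Arguments.
Unset Strict Implicit.
Unset Printing Implicit Defensive.
Import Order.TTheory GRing.Theory Num.Theory.
Import numFieldNormedType.Exports.
Local Open Scope classical_set_scope.
Local Open Scope ring_scope.

(* Functions of time are total on [R]; only their values on [0, +oo[ matter. *)

Definition enorm (R : realType) (n : nat) (x : 'cV[R]_n) : R :=
  Num.sqrt (\sum_i x i ord0 ^+ 2).

(* R with the sigma-algebra of Lebesgue measurable sets, i.e. the completion of
   the Borel sets; the measurable structure of [R] itself is the Borel one. *)
Definition lebesgueType (R : realType) :=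
  g_sigma_algebraType (completed_algebra_gen (@lebesgue_measure R)).

Definition borelMatrix (R : realType) (n : nat) :=
  g_sigma_algebraType (@open 'M[R]_n).

Definition switching_function (R : realType) (n : nat) (AA : set 'M[R]_n)
    (A : R -> 'M[R]_n) : Prop :=
  @measurable_fun _ _ (lebesgueType R) (borelMatrix R n) `[0, +oo[%classic A /\
  forall t : R, 0 <= t -> AA (A t).

Definition abs_continuous (R : realType) (W : normedModType R) (a b : R)
    (f : R -> W) : Prop :=
  forall e : R, 0 < e -> exists2 d : R, 0 < d &
    forall (N : nat) (u v : 'I_N -> R),
      (forall i, a <= u i /\ u i <= v i /\ v i <= b) ->
      trivIset setT (fun i => `]u i, v i[%classic) ->
      \sum_i (v i - u i) < d ->
      \sum_i `|f (v i) - f (u i)| < e.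

(* A.e. differentiability is asked only for t > 0, where the two-sided
   derivative is unaffected by the values of [x] at negative times. *)
Definition caratheodory_solution (R : realType) (n : nat) (A : R -> 'M[R]_n)
    (x0 : 'cV[R]_n) (x : R -> 'cV[R]_n) : Prop :=
  [/\ x 0 = x0,
      forall T : R, 0 < T -> abs_continuous 0 T x &
      \forall t \ae (@lebesgue_measure R),
        0 < t -> is_derive (t : R) (1 : R) x (A t *m x t)].

(* The flow of x' = A(t) x is rendered by quantifying over all Caratheodory
   solutions issued from x0 (for AA bounded there is exactly one on [0, +oo[). *)
Definition GUES (R : realType) (n : nat) (AA : set 'M[R]_n) : Prop :=
  exists M lambda : R, [/\ 0 < M, 0 < lambda &
    forall (x0 : 'cV[R]_n) (t : R) (A : R -> 'M[R]_n) (x : R -> 'cV[R]_n),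
      0 < t -> switching_function AA A -> caratheodory_solution A x0 x ->
      enorm (x t) <= M * expR (- lambda * t) * enorm x0].

Definition common_lyapunov (R : realType) (n : nat) (AA : set 'M[R]_n)
    (V : 'cV[R]_n -> R) : Prop :=
  [/\ continuous V,
      forall x, 0 <= V x,
      V 0 = 0,
      forall x, x != 0 -> 0 < V x &
      forall (A : R -> 'M[R]_n) (x0 : 'cV[R]_n) (x : R -> 'cV[R]_n),
        switching_function AA A -> caratheodory_solution A x0 x ->
        (exists2 t : R, 0 <= t & x t != x0) ->
        forall s t : R, 0 <= s -> s < t -> V (x t) < V (x s)].

Definition is_polynomial (R : realType) (n : nat) (V : 'cV[R]_n -> R) : Prop :=
  exists p : mpoly.mpoly n R, forall x, V x = mpoly.meval (fun i => x i ord0) p.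

(* Main.v *)
Require Import Defs.
From mathcomp Require Import all_boot all_order all_algebra.
From mathcomp Require Import all_classical all_reals all_analysis.
From mathcomp Require Import measurable_realfun ring lra.
From mathcomp Require finmap mpoly.
(* Structures only: the notations of mpoly clash with those of analysis. *)
Import (canonicals) mpoly.
Set Implicit Arguments.
Unset Strict Implicit.
Unset Printing Implicit Defensive.
Import Order.TTheory GRing.Theory Num.Theory.
Import numFieldNormedType.Exports.
Local Open Scope classical_set_scope.
Local Open Scope ring_scope.

(* Fix a small step tau and put r = exp(-lambda tau). By GUES, applied to piecewise
   constant switching functions, the rows of r^-k exp(tau A_k) ... exp(tau A_1),
   A_i in AA, form a bounded set of linear forms; precomposing one of them with
   exp(tau A) gives r times another one. Hence W(x) = sup |L x| over these forms
   is a norm contracted by every exp(tau A), and also by every I + tau A, since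
   exp(tau A) - (I + tau A) = O(tau^2) while 1 - r is of order tau. A finite net F
   of the forms computes W up to a factor close to 1, so that, with N = #F,
     V(x) = sum_(L in F) (L x)^2p  satisfies  V(x + tau A x) <= N q^2p V(x)
   for some q < 1 independent of p, and N q^2p < 1 once p is large. As V is convex,
   tau V'(x)(A x) <= V(x + tau A x) - V(x) <= - c V(x) with c > 0. The same
   argument for I - tau A bounds V'(x)(A x) below by a multiple of V(x), which
   keeps a trajectory away from 0. Both bounds integrate along absolutely
   continuous trajectories. *)

(** * Matrix exponential *)

Section exp_series.
Variable R : realType.

(* Unlike convergence everywhere, this bound is preserved by formal differentiation. *)
Definition exp_dominated (b D : R) (c : nat -> R) :=
  forall k, `|c k| <= D * (b ^+ k / k`!%:R).

Lemma exp_dominated_diffs (b D : R) (c : nat -> R) :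
  exp_dominated b D c -> exp_dominated b (D * b) (pseries_diffs c).
Proof.
move=> cD k; rewrite /pseries_diffs normrM normr_nat.
apply: le_trans (ler_wpM2l _ (cD k.+1)) _; first exact: ler0n.
rewrite le_eqVlt; apply/orP; left; apply/eqP.
rewrite factS natrM exprS invfM.
have h : k.+1%:R != 0 :> R by rewrite pnatr_eq0.
rewrite [X in D * X](_ : _ = k.+1%:R^-1 * (b * (b ^+ k / k`!%:R))); last by ring.
by rewrite mulrCA mulVKf// -[RHS]mulrA.
Qed.

Lemma exp_dominated_ge0 (b D : R) (c : nat -> R) : exp_dominated b D c -> 0 <= D.
Proof. by move=> /(_ 0%N); rewrite expr0 divr1 mulr1; apply: le_trans. Qed.

Lemma exp_dominated_norm_le (b D : R) (c : nat -> R) (t : R) (k : nat) :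
  exp_dominated b D c -> `|c k * t ^+ k| <= D * exp_coeff (b * `|t|) k.
Proof.
move=> cD; rewrite normrM normrX /exp_coeff /= exprMn mulrAC mulrA.
by rewrite ler_wpM2r// exprn_ge0.
Qed.

Lemma is_cvg_normed_pseries_dominated (b D : R) (c : nat -> R) (t : R) :
  0 <= b -> exp_dominated b D c -> cvgn [normed series (fun k => c k * t ^+ k)].
Proof.
move=> b0 cD; apply: (@series_le_cvg _ _ (D *: exp_coeff (b * `|t|))).
- by move=> k; exact: normr_ge0.
- move=> k; rewrite mulr_ge0//; first exact: exp_dominated_ge0 cD.
  by rewrite exp_coeff_ge0// mulr_ge0.
- by move=> k; exact: exp_dominated_norm_le.
- by apply: is_cvg_seriesZ; exact: is_cvg_series_exp_coeff.
Qed.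

Lemma is_cvg_pseries_dominated (b D : R) (c : nat -> R) (t : R) :
  0 <= b -> exp_dominated b D c -> cvgn (pseries c t).
Proof. by move=> b0 cD; apply: normed_cvg; exact: is_cvg_normed_pseries_dominated cD. Qed.

Lemma pseries_dominated_le (b D : R) (c : nat -> R) (t : R) :
  0 <= b -> exp_dominated b D c -> `|limn (pseries c t)| <= D * expR (b * `|t|).
Proof.
move=> b0 cD; have cv := is_cvg_normed_pseries_dominated (t := t) b0 cD.
apply: le_trans (lim_series_norm cv) _.
rewrite /expR -[D * _]/(D *: _) -lim_seriesZ; last exact: is_cvg_series_exp_coeff.
apply: lim_series_le => //; last by move=> k; exact: exp_dominated_norm_le.
by apply: is_cvg_seriesZ; exact: is_cvg_series_exp_coeff.
Qed.

(** Termwise differentiation asks that the series and its first two formal derivatives converge at a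
    point beyond [|t|]. Domination passes to formal derivatives, so [|t| + 1] serves. *)
Lemma is_derive_pseries_dominated (b D : R) (c : nat -> R) (t : R) :
  0 <= b -> exp_dominated b D c ->
  is_derive t 1 (fun s => limn (pseries c s)) (limn (pseries (pseries_diffs c) t)).
Proof.
move=> b0 cD; apply: (@pseries_snd_diffs _ _ (`|t| + 1)).
- exact: is_cvg_pseries_dominated cD.
- exact: is_cvg_pseries_dominated (exp_dominated_diffs cD).
- exact: is_cvg_pseries_dominated (exp_dominated_diffs (exp_dominated_diffs cD)).
- by rewrite [ltRHS]ger0_norm// ltrDl.
Qed.

End exp_series.

Section matrix_exponential.
Variables (R : realType) (n : nat).
Implicit Types A B : 'M[R]_n.

Definition mexp_coeff A (i j : 'I_n) (k : nat) : R := (A ^+ k) i j / k`!%:R.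

(** Defined entry by entry, so that the theory of scalar power series applies directly. *)
Definition mexp A (t : R) : 'M[R]_n :=
  \matrix_(i, j) limn (pseries (mexp_coeff A i j) t).

Lemma mx_norm_coord_le m p (A : 'M[R]_(m, p)) i j : `|A i j| <= `|A|.
Proof.
rewrite [leRHS]/Num.Def.normr/= mx_normrE.
exact: (le_bigmax _ (fun x : 'I_m * 'I_p => `|A x.1 x.2|) (i, j)).
Qed.

Lemma mx_norm_le m p (A : 'M[R]_(m, p)) (e : R) :
  0 <= e -> (forall i j, `|A i j| <= e) -> `|A| <= e.
Proof.
by move=> e0 Ae; rewrite [leLHS]/Num.Def.normr/= mx_normrE bigmax_le.
Qed.

Lemma is_derive_mxP (m p : nat) (M : R -> 'M[R]_(m, p)) (t : R) (dM : 'M[R]_(m, p)) :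
  is_derive t (1 : R) M dM <->
  forall i j, is_derive t (1 : R) (fun s => M s i j) (dM i j).
Proof.
split=> [h i j|h].
  have Md : derivable M t 1 by exact: ex_derive.
  apply: DeriveDef; first exact: (derivable_mxP M t 1).1 Md i j.
  have := @derive_val _ _ _ _ _ _ _ h; rewrite derive_mx// => <-.
  by rewrite mxE.
have Md : derivable M t 1 by apply/derivable_mxP => i j; exact: (@ex_derive _ _ _ _ _ _ _ (h i j)).
apply: DeriveDef => //; rewrite derive_mx//; apply/matrixP => i j.
by rewrite mxE (@derive_val _ _ _ _ _ _ _ (h i j)).
Qed.

Lemma mulmx_coord_le m p q (A : 'M[R]_(m, p)) (B : 'M[R]_(p, q)) (a b : R) i j :
  (forall k, `|A i k| <= a) -> (forall k, `|B k j| <= b) ->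
  `|(A *m B) i j| <= p%:R * a * b.
Proof.
move=> Aa Bb; rewrite mxE; apply: le_trans (ler_norm_sum _ _ _) _.
rewrite -mulrA mulr_natl -[X in _ *+ X]card_ord -sumr_const.
by apply: ler_sum => k _; rewrite normrM ler_pM.
Qed.

(** Each further factor [A] multiplies the bound on the entries of the power by at most
    [n%:R * K]. *)
Lemma mexp_coeff_dominated A (K : R) i j : (forall i j, `|A i j| <= K) ->
  exp_dominated (n%:R * K) 1 (mexp_coeff A i j).
Proof.
move=> AK k; rewrite /mexp_coeff mul1r normrM normfV normr_nat ler_wpM2r//.
elim: k i => [|k IH] i.
  by rewrite !expr0 mxE; case: eqP => _; rewrite ?normr1// normr0.
by rewrite !exprS; apply: mulmx_coord_le => // l; exact: IH.
Qed.

Variables (A : 'M[R]_n) (K : R).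
Hypothesis AK : forall i j, `|A i j| <= K.

Let K_ge0 (i j : 'I_n) : 0 <= n%:R * K.
Proof. by rewrite mulr_ge0// (le_trans _ (AK i j)). Qed.

Lemma mexp_coord_le t i j : `|mexp A t i j| <= expR (n%:R * K * `|t|).
Proof.
rewrite mxE -[leRHS]mul1r; apply: pseries_dominated_le; first exact: K_ge0.
exact: mexp_coeff_dominated.
Qed.

Lemma mexp0 : mexp A 0 = 1%:M.
Proof.
apply/matrixP => i j; rewrite mxE [RHS](_ : _ = mexp_coeff A i j 0); last first.
  by rewrite /mexp_coeff expr0 divr1.
apply/cvg_lim => //; rewrite -(@cvg_shiftS _); apply: cvg_near_cst.
near=> k; rewrite /pseries /series /= big_nat_recl//= big1 ?addr0 ?mulr1//.
by move=> l _; rewrite expr0n mulr0.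
Unshelve. all: by end_near. Qed.

Lemma is_derive_mexp_coord (t : R) i j :
  is_derive t (1 : R) (fun s => mexp A s i j) ((A *m mexp A t) i j).
Proof.
under eq_fun do rewrite mxE.
have dom := mexp_coeff_dominated _ _ AK.
have -> : (A *m mexp A t) i j = limn (pseries (pseries_diffs (mexp_coeff A i j)) t).
  apply/esym/cvg_lim => //; rewrite mxE.
  (* The k-th coefficient of the derived series is an entry of A^(k+1) / k!. Writing A^(k+1) = A A^k
     and exchanging the two finite sums exhibits the partial sums of A exp(tA). *)
  have -> : pseries (pseries_diffs (mexp_coeff A i j)) t =
      fun N => \sum_l A i l * pseries (mexp_coeff A l j) t N.
    apply/funext => N; rewrite /pseries /series /=.
    under [RHS]eq_bigr do rewrite mulr_sumr.
    rewrite exchange_big; apply: eq_bigr => k _ /=.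
    rewrite /pseries_diffs /mexp_coeff factS natrM exprS invfM.
    have h : k.+1%:R != 0 :> R by rewrite pnatr_eq0.
    rewrite [_.+1%:R * _]mulrCA mulVKf//.
    rewrite mxE !mulr_suml; apply: eq_bigr => l _.
    by rewrite !mulrA.
  apply: cvg_big => [|l _]; [exact: add_continuous|apply: cvgMl_tmp; rewrite mxE].
  exact: is_cvg_pseries_dominated (K_ge0 i j) (dom _ _).
exact: is_derive_pseries_dominated (K_ge0 i j) (dom _ _).
Qed.

Lemma is_derive_mexp_mul (x0 : 'cV[R]_n) (t : R) :
  is_derive t (1 : R) (fun s => mexp A s *m x0) (A *m (mexp A t *m x0)).
Proof.
apply/is_derive_mxP => i j; rewrite (ord1 j) mulmxA mxE.
rewrite (_ : (fun _ => _) = \sum_j (fun s => mexp A s i j * x0 j ord0)); last first.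
  by apply/funext => s; rewrite mxE fct_sumE.
apply: is_derive_sum => k.
have h := is_derive_mexp_coord t i k.
have := @is_deriveM _ _ _ _ _ _ _ _ h (is_derive_cst (x0 k ord0) t 1).
rewrite (_ : _ *: 0 + _ = (A *m mexp A t) i k * x0 k ord0)//.
by rewrite scaler0 add0r [LHS]mulrC.
Qed.

End matrix_exponential.

Section matrix_exponential_estimates.
Variable R : realType.

Lemma le_derive_lipschitz (f df : R -> R) (a b C : R) : a <= b ->
  (forall t, a <= t <= b -> is_derive t (1 : R) f (df t)) ->
  (forall t, a <= t <= b -> `|df t| <= C) ->
  `|f b - f a| <= C * (b - a).
Proof.
move=> ab fdf dfC.
have cf : {within `[a, b], continuous f}.
  apply: derivable_within_continuous => t; rewrite in_itv /= => tab.
  by have := fdf _ tab => h; exact: ex_derive.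
have [|c cab ->] := @MVT_segment _ f df a b ab _ cf.
  move=> t; rewrite in_itv /= => /andP[at_ tb]; apply: fdf.
  by rewrite (ltW at_) (ltW tb).
rewrite normrM [`|b - a|]ger0_norm ?subr_ge0// ler_wpM2r ?subr_ge0//.
by apply: dfC; move: cab; rewrite in_itv.
Qed.

Variables (n : nat) (A : 'M[R]_n) (K : R).
Hypothesis AK : forall i j, `|A i j| <= K.

Let b := n%:R * K.

Let b_ge0 (i j : 'I_n) : 0 <= b.
Proof. by rewrite mulr_ge0// (le_trans _ (AK i j)). Qed.

Lemma derive_mexp_coord_le (t T : R) i j : 0 <= t <= T ->
  `|(A *m mexp A t) i j| <= b * expR (b * T).
Proof.
move=> /andP[t0 tT]; apply: mulmx_coord_le => // k.
apply: le_trans (mexp_coord_le AK _ _ _) _.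
by rewrite ler_expR ger0_norm// ler_wpM2l// (b_ge0 i j).
Qed.

Lemma mexp_lipschitz (T u v : R) i j : 0 <= u -> u <= v -> v <= T ->
  `|mexp A v i j - mexp A u i j| <= b * expR (b * T) * (v - u).
Proof.
move=> u0 uv vT.
apply: (@le_derive_lipschitz (fun t => mexp A t i j)
  (fun t => (A *m mexp A t) i j)) => // t /andP[ut tv].
  exact: is_derive_mexp_coord AK _ i j.
by apply: derive_mexp_coord_le; rewrite // (le_trans u0 ut) (le_trans tv vT).
Qed.

(** Once the linear term is subtracted, the derivative at s is an entry of A (exp(sA) - I), of order
    s by the Lipschitz bound; a second mean value estimate gives order t^2. *)
Lemma mexp_second_order (t : R) i j : 0 <= t <= 1 ->
  `|(mexp A t - 1%:M - t *: A) i j| <= b ^+ 2 * expR b * t ^+ 2.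
Proof.
move=> /andP[t0 t1].
pose f s := mexp A s i j - s * A i j.
have h : `|f t - f 0| <= b ^+ 2 * expR b * t * (t - 0).
  apply: (@le_derive_lipschitz f (fun s => (A *m mexp A s) i j - A i j)) => //.
    move=> s _; apply: is_deriveB; first exact: is_derive_mexp_coord AK _ i j.
    by apply: is_derive_eq; rewrite scaler0 add0r /GRing.scale /= mulr1.
  move=> s /andP[s0 st].
  rewrite (_ : _ - _ = (A *m (mexp A s - 1%:M)) i j); last first.
    by rewrite mulmxBr mulmx1 !mxE.
  rewrite (_ : _ * _ * _ = n%:R * K * (b * expR b * t)); last by rewrite -/b; ring.
  apply: mulmx_coord_le => // k.
  have := @mexp_lipschitz s 0 s k j (lexx 0) s0 (lexx s).
  rewrite (mexp0 A) subr0 => /le_trans; rewrite !mxE; apply.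
  apply: ler_pM => //; first by rewrite mulr_ge0 ?expR_ge0 ?(b_ge0 i j).
  rewrite ler_wpM2l ?(b_ge0 i j)// ler_expR ler_piMr ?(b_ge0 i j)//.
  exact: le_trans st t1.
move: h; rewrite /f (mexp0 A) mul0r !subr0 -mulrA -expr2; apply: le_trans.
by rewrite !mxE addrAC.
Qed.

End matrix_exponential_estimates.

(** * Trajectories for piecewise constant switching functions *)

Section solutions.
Variables (R : realType) (n : nat).

(** Stronger than absolute continuity on each [0, T], and easier to carry through concatenations of
    trajectories. *)
Definition locally_lipschitz (W : normedModType R) (x : R -> W) :=
  forall T : R, exists2 C : R, 0 <= C & forall u v, 0 <= u -> u <= v -> v <= T ->
    `|x v - x u| <= C * (v - u).

Lemma locally_lipschitz_abs_continuous (W : normedModType R) (x : R -> W) (T : R) :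
  locally_lipschitz x -> abs_continuous 0 T x.
Proof.
move=> /(_ T)[C C0 xC] e e0; exists (e / (C + 1)).
  by rewrite divr_gt0// ltr_wpDl.
move=> N u v uv _ suv.
apply: (@le_lt_trans _ _ (\sum_i (C + 1) * (v i - u i))).
  apply: ler_sum => i _; have [ui [uvi vi]] := uv i.
  apply: le_trans (xC _ _ ui uvi vi) _.
  by rewrite ler_wpM2r ?subr_ge0// lerDl.
by rewrite -mulr_sumr mulrC -ltr_pdivlMr// ltr_wpDl.
Qed.

Lemma measurable_lebesgueType (S : set R) : measurable S ->
  measurable (S : set (lebesgueType R)).
Proof.
move=> mS; rewrite [measurable]g_sigma_completed_algebra_genE.
by exists S => //; exists set0; [exact: negligible_set0|rewrite setU0].
Qed.

End solutions.

Section piecewise_exponential_trajectories.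
Variables (R : realType) (n : nat).
Implicit Types (A B : 'M[R]_n) (AA : set 'M[R]_n).

Lemma ae_neq (T : R) : \forall t \ae (@lebesgue_measure R), t != T.
Proof.
exists [set T]; split => //; first exact: lebesgue_measure_set1.
by move=> t /= /negP; rewrite negbK => /eqP.
Qed.

Lemma locally_lipschitz_mexp A (x0 : 'cV[R]_n) : locally_lipschitz (fun t => mexp A t *m x0).
Proof.
move=> T; have AK i j : `|A i j| <= `|A| by exact: mx_norm_coord_le.
pose c := n%:R * `|A| * expR (n%:R * `|A| * T).
have c0 : 0 <= c by rewrite !mulr_ge0 ?expR_ge0.
exists (n%:R * c * `|x0|); first by rewrite !mulr_ge0.
move=> u v u0 uv vT; rewrite -mulmxBl; apply: mx_norm_le.
  by rewrite !mulr_ge0 ?subr_ge0.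
move=> i j; rewrite [leRHS](_ : _ = n%:R * (c * (v - u)) * `|x0|); last by ring.
apply: mulmx_coord_le => k; last exact: mx_norm_coord_le.
by rewrite !mxE; have := mexp_lipschitz AK i k u0 uv vT; rewrite !mxE.
Qed.

Lemma locally_lipschitz_concat (W : normedModType R) (x y : R -> W) (T : R) :
  x T = y 0 -> 0 <= T -> locally_lipschitz x -> locally_lipschitz y ->
  locally_lipschitz (fun t => if t <= T then x t else y (t - T)).
Proof.
move=> xy T0 xl yl S; have [C C0 xC] := xl T; have [D D0 yD] := yl (S - T).
exists (C + D) => [|u v u0 uv vS]; first exact: addr_ge0.
case: (leP u T) (leP v T) => [uT|Tu] [vT|Tv].
- apply: le_trans (xC _ _ u0 uv vT) _.
  by rewrite ler_wpM2r ?subr_ge0// lerDl.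
- have := xC _ _ u0 uT (lexx T).
  have := yD 0 (v - T) (lexx _) _ _; rewrite subr_ge0 lerB// subr0 => /(_ (ltW Tv) isT).
  rewrite -xy => hv hu.
  rewrite -(subrKA (x T)); apply: le_trans (ler_normD _ _) _.
  apply: le_trans (lerD hv hu) _.
  rewrite mulrDl addrC lerD// ler_wpM2l// ?lerB//.
  exact: ltW.
- by have := lt_le_trans Tu (le_trans uv vT); rewrite ltxx.
- have := yD (u - T) (v - T); rewrite subr_ge0 !lerB// => /(_ (ltW Tu) isT isT).
  rewrite (_ : v - T - (u - T) = v - u); last by ring.
  move=> /le_trans; apply.
  by rewrite ler_wpM2r ?subr_ge0// lerDr.
Qed.

Lemma switching_function_cst AA A : AA A -> switching_function AA (fun=> A).
Proof. by move=> AAA; split => //; exact: measurable_cst. Qed.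

Lemma switching_function_concat AA (A : R -> 'M[R]_n) B (T : R) :
  switching_function AA A -> AA B ->
  switching_function AA (fun t => if t < T then A t else B).
Proof.
move=> [mA AAA] AAB; split; last by move=> t t0; case: ifP => // _; exact: AAA.
move=> mD Y mY.
have mlt : measurable (`]-oo, T[%classic : set (lebesgueType R)).
  exact: measurable_lebesgueType.
have {}mB : measurable (`[0, +oo[%classic `&` cst B @^-1` Y : set (lebesgueType R)).
  by have [+ _] := switching_function_cst AAB => /(_ mD Y mY).
rewrite (_ : _ `&` _ = (`]-oo, T[ `&` (`[0, +oo[ `&` A @^-1` Y)) `|`
    (~` `]-oo, T[ `&` (`[0, +oo[ `&` cst B @^-1` Y))); last first.
  apply/seteqP; split => t /=; rewrite !in_itv /= ?andbT.
    by case: ifPn => tT [t0 Yt]; [left|right].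
  by move=> [[tT [t0 Yt]]|[/negP/negbTE tT [t0 Yt]]]; rewrite tT.
apply: measurableU; apply: measurableI => //.
- exact: mA.
- exact: measurableC.
Qed.

Lemma caratheodory_solution_mexp A (x0 : 'cV[R]_n) :
  caratheodory_solution (fun=> A) x0 (fun t => mexp A t *m x0).
Proof.
split; first by rewrite mexp0 mul1mx.
- by move=> T _; apply: locally_lipschitz_abs_continuous; exact: locally_lipschitz_mexp.
- apply: aeW => t _; apply: (@is_derive_mexp_mul _ _ _ `|A|).
  by move=> i j; exact: mx_norm_coord_le.
Qed.

(** The trajectory is restarted at time [T] with the constant matrix [B]. Differentiability may fail
    at the switching time itself, which is a null set; the Lipschitz property yields absolute
    continuity across it. *)
Lemma caratheodory_solution_concat (A : R -> 'M[R]_n) B (x0 : 'cV[R]_n)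
    (x : R -> 'cV[R]_n) (T : R) :
  0 <= T -> caratheodory_solution A x0 x -> locally_lipschitz x ->
  let y t := if t <= T then x t else mexp B (t - T) *m x T in
  caratheodory_solution (fun t => if t < T then A t else B) x0 y /\ locally_lipschitz y.
Proof.
move=> T0 [xx0 _ dx] xl y.
have yl : locally_lipschitz y.
  apply: (@locally_lipschitz_concat _ x (fun t => mexp B t *m x T)) => //.
    by rewrite mexp0 mul1mx.
  exact: locally_lipschitz_mexp.
split => //; split; first by rewrite /y T0.
- by move=> S _; exact: locally_lipschitz_abs_continuous.
have FF := ae_filter_ringOfSetsType (@lebesgue_measure R).
apply: (@filterS2 _ _ FF _ _ _ _ dx (ae_neq T)) => t dxt tT t0.
case: (ltgtP t T) tT => // tT _.
- rewrite {2}/y (ltW tT).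
  apply: near_eq_is_derive (dxt t0).
  near=> s; rewrite /y ifT//; apply: ltW.
  by near: s; exact: lt_nbhsl.
- rewrite {2}/y leNgt tT /=.
  apply: (@near_eq_is_derive _ _ _ (fun s => mexp B (s - T) *m x T)).
    near=> s; rewrite /y ifF//; apply/negbTE; rewrite -ltNge.
    by near: s; exact: lt_nbhsr.
  have BK i j : `|B i j| <= `|B| by exact: mx_norm_coord_le.
  have h := is_derive_mexp_mul BK (x T) (t - T).
  apply/is_derive_mxP => i j; have /is_derive_mxP /(_ i j) hij := h.
  rewrite -[X in is_derive _ _ _ X]mulr1.
  apply: (@is_derive1_comp _ (fun s => (mexp B s *m x T) i j) (fun s => s - T)) => //.
  exact: is_derive_shift.
Unshelve. all: by end_near. Qed.

(** This realizes products of exponentials as values of trajectories, so that GUES can bound them.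
    The head of the list is the leftmost factor, hence the matrix active on the last interval; [A0]
    starts the induction at the empty product. *)
Lemma product_mexp_trajectory AA (A0 : 'M[R]_n) (tau : R) (x0 : 'cV[R]_n) (s : seq 'M[R]_n) :
  0 <= tau -> AA A0 -> (forall A, A \in s -> AA A) ->
  exists (A : R -> 'M[R]_n) (x : R -> 'cV[R]_n),
  [/\ switching_function AA A, caratheodory_solution A x0 x,
      locally_lipschitz x & x ((size s)%:R * tau) = (\prod_(B <- s) mexp B tau) *m x0].
Proof.
move=> tau0 AA0; elim: s => [|B s IH] sAA.
  exists (fun=> A0), (fun t => mexp A0 t *m x0); split.
  - exact: switching_function_cst.
  - exact: caratheodory_solution_mexp.
  - exact: locally_lipschitz_mexp.
  - by rewrite mul0r mexp0 big_nil.
have [A [x [sA cx lx xs]]] := IH (fun A As => sAA A (mem_behead (s := B :: s) As)).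
have T0 : 0 <= (size s)%:R * tau by rewrite mulr_ge0.
have AAB : AA B by apply: sAA; rewrite mem_head.
have [cy ly] := caratheodory_solution_concat B T0 cx lx.
eexists; eexists; split;
  [exact: (switching_function_concat ((size s)%:R * tau) sA AAB)|exact: cy|exact: ly|].
have -> : \prod_(H <- B :: s) mexp H tau *m x0 = mexp B tau *m x ((size s)%:R * tau).
  by rewrite xs mulmxA big_cons.
rewrite /= -natr1 mulrDl mul1r addrAC subrr add0r.
(* The final time falls in the first branch of the concatenation only if [tau] is 0, and then the
   added factor is the identity. *)
case: ifPn => [h|//].
have tau_eq0 : tau = 0 by apply/eqP; rewrite eq_le tau0 andbT -(gerDl ((size s)%:R * tau)).
by rewrite tau_eq0 mulr0 addr0 mexp0 mul1mx.
Qed.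

End piecewise_exponential_trajectories.

(** * Absolutely continuous functions *)

Section abs_continuous_monotone.
Variable R : realType.
Notation mu := (@lebesgue_measure R).

(** Transfers absolute continuity through a Lipschitz map ([D] = 0) and through multiplication by a
    Lipschitz factor. *)
Lemma abs_continuous_dominated (W W' : normedModType R) (a b C D : R)
    (f : R -> W) (g : R -> W') : 0 <= C -> 0 <= D ->
  (forall u v, a <= u -> u <= v -> v <= b ->
    `|g v - g u| <= C * `|f v - f u| + D * (v - u)) ->
  abs_continuous a b f -> abs_continuous a b g.
Proof.
move=> C0 D0 gf fac e e0.
(* Each of the two terms receives half of [e]; adding 1 keeps the divisors positive when [C] or [D]
   vanishes. *)
have C1 : 0 < 2 * (C + 1) by rewrite mulr_gt0// ltr_wpDl.
have D1 : 0 < 2 * (D + 1) by rewrite mulr_gt0// ltr_wpDl.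
have [d d0 fd] := fac (e / (2 * (C + 1))) (divr_gt0 e0 C1).
exists (Num.min d (e / (2 * (D + 1)))); first by rewrite lt_min d0 divr_gt0.
move=> N u v uv disj; rewrite lt_min => /andP[/(fd _ _ _ uv disj) sf sD].
apply: (@le_lt_trans _ _ (C * \sum_i `|f (v i) - f (u i)| + D * \sum_i (v i - u i))).
  rewrite !mulr_sumr -big_split /=; apply: ler_sum => i _.
  by have [? [? ?]] := uv i; exact: gf.
have s0 : 0 <= \sum_i (v i - u i).
  by apply: sumr_ge0 => i _; rewrite subr_ge0; have [_ []] := uv i.
have s1 : 0 <= \sum_i `|f (v i) - f (u i)| by exact: sumr_ge0.
move: sf sD; rewrite !ltr_pdivlMr// => sf sD.
nra.
Qed.

(** The difference quotient is controlled on either side of [t]; an interval straddling [t] is cut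
    there and the two increments are added. *)
Lemma is_derive_le_local (f : R -> R) (t df e : R) :
  is_derive t (1 : R) f df -> df < e ->
  exists2 d : R, 0 < d & forall p q, t - d < p -> p <= t -> t <= q -> q < t + d ->
    f q - f p <= e * (q - p).
Proof.
move=> fdf dfe.
have fd : derivable f t 1 by exact: ex_derive.
have := @derive_val _ _ _ _ _ _ _ fdf; rewrite /derive => lim_df.
have cv : h^-1 *: (f (h *: 1 + t) - f t) @[h --> (0:R)^'] --> df.
  by rewrite -lim_df; exact: fd.
have /cvgr_lt /(_ e dfe) := cv.
rewrite near_withinE near_simpl => /nbhs_ballP[d /= d0 dP].
have loc h : `|h| < d -> h != 0 -> h^-1 * (f (h + t) - f t) < e.
  move=> hd h0; have := dP h; rewrite /ball /= sub0r normrN => /(_ hd h0).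
  by rewrite [h *: 1]mulr1.
exists d => // p q tp pt tq qt.
have hq : f q - f t <= e * (q - t).
  move: tq; rewrite le_eqVlt => /predU1P[<-|tq]; first by rewrite !subrr mulr0.
  have qt0 : 0 < q - t by rewrite subr_gt0.
  have := loc (q - t); rewrite gtr0_norm// subrK => /(_ _ _)/ltW.
  rewrite ler_pdivrMl// mulrC; apply; last by rewrite gt_eqF.
  by rewrite ltrBlDl.
have hp : f t - f p <= e * (t - p).
  move: pt; rewrite le_eqVlt => /predU1P[->|pt]; first by rewrite !subrr mulr0.
  have pt0 : p - t < 0 by rewrite subr_lt0.
  have := loc (p - t); rewrite ltr0_norm// subrK => /(_ _ _)/ltW.
  rewrite ler_ndivrMl// => /(_ _ _); rewrite lt_eqF// opprB => H.
  have := H _ isT; rewrite ltrBlDr -ltrBlDl => /(_ tp); lra.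
lra.
Qed.

Lemma open_lebesgue_null (P : R -> Prop) (d : R) : 0 < d ->
  (\forall t \ae mu, P t) ->
  exists U : set R, [/\ open U, (mu U < d%:E)%E & forall t, ~ P t -> U t].
Proof.
move=> d0 [N [mN N0 PN]].
have [|U [oU NU Ud]] := lebesgue_regularity_outer mN _ d0.
  by apply: (@le_lt_trans _ _ 0%E); [rewrite le_eqVlt; apply/orP; left; exact/eqP|exact: ltry].
exists U; split => //; last by move=> t Pt; apply/NU/PN.
rewrite -(setDUK NU) setUC measureU0//.
by apply: measurableD => //; exact: open_measurable.
Qed.

(** Let s be the supremum of the points of [a, b] where [P] holds. Some such point lies just below
    s, and the step hypothesis carries [P] from it past s, unless s = b. *)
Lemma real_induction (a b : R) (P : R -> Prop) : a <= b -> P a ->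
  (forall s, a <= s <= b -> exists2 d, 0 < d &
    forall p q, s - d < p -> p <= s -> s <= q -> q < s + d -> a <= p -> q <= b ->
      P p -> P q) ->
  P b.
Proof.
move=> ab Pa step.
pose S := [set t | a <= t <= b /\ P t].
have Sa : S a by split => //; rewrite lexx.
have supS : has_sup S by split; [exists a|exists b => t [/andP[]]].
have aS : a <= sup S by apply: sup_upper_bound.
have Sb : sup S <= b by apply: ge_sup; [exists a|move=> t [/andP[]]].
have [|d d0 dP] := step (sup S); first by rewrite aS Sb.
have [p [/andP[ap pb] Pp] dp] := sup_adherent d0 supS.
have pS : p <= sup S.
  by apply: sup_upper_bound => //; split => //; rewrite ap.
(* This point lies strictly beyond the supremum unless it equals [b]. *)
pose q := Num.min b (sup S + d / 2).
have Sq : sup S <= q by rewrite le_min Sb lerDl divr_ge0// ltW.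
have qb : q <= b by rewrite ge_min lexx.
have Pq : P q.
  apply: (dP p q) => //; rewrite gt_min; apply/orP; right.
  by rewrite ltrD2l ltr_pdivrMr// ltr_pMr// ltr1n.
have : q <= sup S by apply: sup_upper_bound => //; split => //; rewrite (le_trans aS Sq).
rewrite ge_min => /orP[bS|]; last by rewrite gerDl leNgt divr_gt0.
by have -> : b = q by apply/eqP; rewrite eq_le qb andbT (le_trans bS Sq).
Qed.

(* The exceptional null set lies in an open set U of measure less than d. Real
   induction from a to b uses intervals that are either contained in U, whose total
   contribution is small by absolute continuity, or on which f increases by at most
   e' / 2 times the length. *)
Lemma abs_continuous_nonincreasing (f : R -> R) (a b : R) : a <= b ->
  abs_continuous a b f ->
  (\forall t \ae mu, a < t -> t < b -> exists2 df : R, df <= 0 & is_derive t (1 : R) f df) ->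
  f b <= f a.
Proof.
move=> ab fac fd; apply/ler_addgt0Pr => e e0.
(* Slope [e' / 2] along [a, b] and a contribution of at most [e' / 2] from the exceptional set add
   up to [e / 2]. *)
pose e' := e / (b - a + 1).
have ba1 : 0 < b - a + 1 by rewrite ltr_wpDl// subr_ge0.
have e'0 : 0 < e' / 2 by rewrite !divr_gt0.
have e20 : 0 < e / 2 by rewrite divr_gt0.
have [d d0 facd] := fac _ e'0.
pose good t := a < t < b /\ exists2 df : R, df <= 0 & is_derive t (1 : R) f df.
(* Despite its name, this is the property that holds almost everywhere. It fails at [a] and [b], so
   the open set [U] below contains both endpoints. *)
pose bad t := a <= t <= b -> good t.
have aebad : \forall t \ae mu, bad t.
  have FF := ae_filter_ringOfSetsType mu.
  apply: (@filterS3 _ _ FF _ _ _ _ _ fd (ae_neq a) (ae_neq b)) => t dft ta tb /andP[at_ tb_].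
  have at' : a < t by rewrite lt_neqAle eq_sym ta.
  have tb' : t < b by rewrite lt_neqAle tb.
  by split; [rewrite at'|exact: dft].
have [U [oU Ud badU]] := open_lebesgue_null d0 aebad.
have mU : measurable U by exact: open_measurable.
pose meas t := mu (U `&` `]a, t]).
(* Invariant of the induction: the increment of [f] up to [t] is paid for by the slope [e' / 2] and
   by finitely many ordered intervals whose total length is at most the measure of the part of [U]
   already crossed. The bound by [meas t] lets an interval inside [U] be appended. *)
pose P t := exists (N : nat) (u v : nat -> R),
  [/\ forall i, (i < N)%N -> a <= u i /\ u i <= v i /\ v i <= t,
      forall i j, (i < j)%N -> (j < N)%N -> v i <= u j,
      ((\sum_(i < N) (v i - u i))%:E <= meas t)%E &
      f t - f a <= e' / 2 * (t - a) + \sum_(i < N) `|f (v i) - f (u i)|].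
have Pb : P b.
  apply: (@real_induction a b) => //.
    exists 0%N, (fun=> 0), (fun=> 0); split => //; rewrite big_ord0//.
    by rewrite !subrr mulr0 addr0.
  move=> s sab.
  suff [r r0 H] : exists2 r : R, 0 < r & forall p q, s - r < p -> p <= s -> s <= q -> q < s + r ->
      `]p, q] `<=` U \/ f q - f p <= e' / 2 * (q - p).
    exists r => // p q srp ps sq qsr ap qb [N [u [v [uv disj meas_uv fp]]]].
    have pq := le_trans ps sq.
    have [pqU|fpq] := H p q srp ps sq qsr; last first.
      exists N, u, v; split => //.
      - by move=> i /uv [? [? vp]]; split => //; split => //; exact: le_trans vp pq.
      - apply: le_trans meas_uv _; apply: le_measure; rewrite ?inE.
        + exact: measurableI.
        + exact: measurableI.
        + by apply: setIS => x /=; rewrite !in_itv /= => /andP[-> /le_trans]; exact.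
      - have -> : f q - f a = (f q - f p) + (f p - f a) by ring.
        by apply: le_trans (lerD fpq fp) _; rewrite addrA lerD2r; nra.
    exists N.+1, (fun i => if i == N then p else u i), (fun i => if i == N then q else v i).
    split.
    - move=> i; rewrite ltnS leq_eqVlt; case: eqP => [_ _|_ /= /uv[? [? vp]]] //.
      by split => //; split => //; exact: le_trans vp pq.
    - move=> i j ij; rewrite ltnS => jN.
      have iN := leq_trans ij jN.
      rewrite (ltn_eqF iN); case: eqP => [_|/eqP jN']; first by have [_ []] := uv _ iN.
      by apply: disj => //; rewrite ltn_neqAle jN'.
    - rewrite big_ord_recr /= eqxx.
      under eq_bigr do rewrite (ltn_eqF (ltn_ord _)).
      rewrite EFinD.
      have -> : meas q = (meas p + mu `]p, q])%E.
        rewrite /meas -measureU//; [congr (mu _)|exact: measurableI|].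
          apply/seteqP; split => [x [Ux]|x [[Ux]|pxq]] /=; rewrite !in_itv /=.
          + move=> /andP[ax xq]; case: (leP x p) => xp; first by left; split => //; rewrite ax.
            by right; rewrite xq.
          + by move=> /andP[-> xp]; split => //; exact: le_trans xp pq.
          + split; first exact: pqU.
            move: pxq; rewrite /= in_itv /= => /andP[px ->].
            by rewrite andbT (le_lt_trans ap).
        rewrite -subset0 => x [[_ /=]]; rewrite !in_itv /= => /andP[_ xp] /andP[].
        by rewrite ltNge xp.
      rewrite leeD//.
      rewrite lebesgue_measure_itv /= lte_fin; case: ifPn => //.
      by rewrite -leNgt => qp; rewrite lee_fin subr_le0.
    - rewrite big_ord_recr /= eqxx.
      under eq_bigr do rewrite (ltn_eqF (ltn_ord _)).
      have -> : f q - f a = (f p - f a) + (f q - f p) by ring.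
      rewrite [leRHS]addrA; apply: lerD; last exact: ler_norm.
      by apply: le_trans fp _; rewrite lerD2r ler_wpM2l ?lerB// ltW.
  have [Us|nUs] := pselect (U s).
    have /nbhs_ballP[r /= r0 rU] : nbhs s U by exact: open_nbhs_nbhs.
    exists r => // p q srp ps sq qsr; left => x /=; rewrite in_itv /= => /andP[px xq].
    apply: rU; rewrite /ball /= ltr_distlC.
    by rewrite (lt_trans srp px) (le_lt_trans xq qsr).
  have [_ [df df0 fdf]] : good s.
    by apply: contrapT => gs; apply: nUs; apply: badU => /(_ sab).
  have [r r0 H] := is_derive_le_local fdf (le_lt_trans df0 e'0).
  by exists r => // p q *; right; exact: H.
have [N [u [v [uv disj meas_uv fb]]]] := Pb.
have sd : \sum_(i < N) (v i - u i) < d.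
  rewrite -lte_fin; apply: le_lt_trans meas_uv _; apply: le_lt_trans Ud.
  by apply: le_measure; rewrite ?inE//; exact: measurableI.
have dj : trivIset setT (fun i : 'I_N => `]u i, v i[%classic).
  move=> i j _ _ [x [/=]]; rewrite !in_itv /= => /andP[ux xv] /andP[ux' xv'].
  case: (ltngtP i j) => ij; last exact: val_inj.
  - have := disj _ _ ij (ltn_ord j); move=> /(lt_le_trans xv) /lt_trans /(_ ux').
    by rewrite ltxx.
  - have := disj _ _ ij (ltn_ord i); move=> /(lt_le_trans xv') /lt_trans /(_ ux).
    by rewrite ltxx.
have := facd N _ _ (fun i => uv i (ltn_ord i)) dj sd => sf.
rewrite addrC -lerBlDr; apply: le_trans fb _.
have : e' * (b - a + 1) = e by rewrite divfK// gt_eqF.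
move: (subr_ge0 a b); rewrite ab => ba0 ee.
apply: le_trans (lerD (lexx _) (ltW sf)) _.
nra.
Qed.

End abs_continuous_monotone.

Section exponential_comparison.
Variable R : realType.

Lemma expR_lipschitz (k a u v b : R) : a <= u -> u <= v -> v <= b ->
  `|expR (k * (v - a)) - expR (k * (u - a))| <= `|k| * expR (`|k| * (b - a)) * (v - u).
Proof.
move=> au uv vb.
apply: (@le_derive_lipschitz _ (fun t => expR (k * (t - a)))
  (fun t => k * expR (k * (t - a)))) => // t /andP[ut tv].
  apply: is_derive_eq; rewrite /GRing.scale /=; ring.
rewrite normrM (gtr0_norm (expR_gt0 _)) ler_wpM2l// ler_expR.
have ta : 0 <= t - a by rewrite subr_ge0 (le_trans au).
apply: le_trans (ler_norm _) _; rewrite normrM (ger0_norm ta) ler_wpM2l//.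
by rewrite lerB// (le_trans tv).
Qed.

(** Gronwall comparison: after multiplication by the integrating factor exp(-k (t - a)), the
    derivative is almost everywhere nonpositive. The bound [B] serves to make the product absolutely
    continuous. *)
Lemma abs_continuous_exp_comparison (f : R -> R) (a b k B : R) : a <= b ->
  abs_continuous a b f -> (forall t, a <= t <= b -> `|f t| <= B) ->
  (\forall t \ae (@lebesgue_measure R), a < t -> t < b ->
    exists2 df : R, df <= k * f t & is_derive t (1 : R) f df) ->
  f b <= expR (k * (b - a)) * f a.
Proof.
move=> ab fac fB fd.
pose g t := expR (- k * (t - a)) * f t.
have B0 : 0 <= B by apply: le_trans (fB a _); rewrite // lexx.
have gba : g b <= g a.
  apply: abs_continuous_nonincreasing => //.
    pose C := expR (`|k| * (b - a)).
    apply: (@abs_continuous_dominated _ _ _ a b C (`|k| * C * B) f g) => //.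
    - exact: expR_ge0.
    - by rewrite !mulr_ge0// expR_ge0.
    move=> u v au uv vb.
    have -> : g v - g u = expR (- k * (v - a)) * (f v - f u) +
        (expR (- k * (v - a)) - expR (- k * (u - a))) * f u by rewrite /g; ring.
    apply: le_trans (ler_normD _ _) _; rewrite !normrM; apply: lerD.
      rewrite ler_wpM2r// gtr0_norm ?expR_gt0// ler_expR.
      have va : 0 <= v - a by rewrite subr_ge0 (le_trans au).
      apply: le_trans (ler_norm _) _; rewrite normrM normrN (ger0_norm va).
      by rewrite ler_wpM2l// lerB.
    rewrite mulrAC; apply: ler_pM => //.
      by have := expR_lipschitz (- k) au uv vb; rewrite normrN.
    by apply: fB; rewrite au (le_trans uv).
  have FF := ae_filter_ringOfSetsType (@lebesgue_measure R).
  apply: (@filterS _ _ FF) fd => t fdt at_ tb; have [df dfk fdf] := fdt at_ tb.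
  exists (expR (- k * (t - a)) * (df - k * f t)).
    by rewrite pmulr_rle0 ?expR_gt0// subr_le0.
  by apply: is_derive_eq; rewrite /GRing.scale /=; ring.
move: gba; rewrite /g subrr mulr0 expR0 mul1r mulNr expRN.
by rewrite ler_pdivrMl ?expR_gt0.
Qed.

End exponential_comparison.

(** * Sums of even powers of linear forms *)

Section power_sum.
Variables (R : realType) (n : nat).
Implicit Types (L : 'rV[R]_n) (x y h : 'cV[R]_n) (F : seq 'rV[R]_n).

Definition lform L x : R := (L *m x) ord0 ord0.

Definition power_sum F (p : nat) x : R := \sum_(L <- F) lform L x ^+ p.*2.

(** The differential of [power_sum F p] at [x], applied to [h]. *)
Definition power_sum_diff F (p : nat) x h : R :=
  \sum_(L <- F) p.*2%:R * lform L x ^+ p.*2.-1 * lform L h.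

Lemma lformD L x y : lform L (x + y) = lform L x + lform L y.
Proof. by rewrite /lform mulmxDr mxE. Qed.

Lemma lformN L x : lform L (- x) = - lform L x.
Proof. by rewrite /lform mulmxN mxE. Qed.

Lemma lformZ L (a : R) x : lform L (a *: x) = a * lform L x.
Proof. by rewrite /lform -scalemxAr mxE. Qed.

Lemma lform_mulmx L (A : 'M[R]_n) x : lform (L *m A) x = lform L (A *m x).
Proof. by rewrite /lform mulmxA. Qed.

Lemma lform_le L x (a b : R) : (forall j, `|L ord0 j| <= a) -> (forall j, `|x j ord0| <= b) ->
  `|lform L x| <= n%:R * a * b.
Proof. by move=> La xb; exact: mulmx_coord_le. Qed.

(** By induction: the gap at exponent p + 1 is z times the gap at p, plus the nonnegative term p
    w^(p-1) (z - w)^2. *)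
Lemma exprn_tangent_le (w z : R) (p : nat) : 0 <= w -> 0 <= z ->
  w ^+ p + p%:R * w ^+ p.-1 * (z - w) <= z ^+ p.
Proof.
move=> w0 z0; elim: p => [|p IH]; first by rewrite !expr0 !mul0r addr0.
rewrite -subr_ge0.
suff -> : z ^+ p.+1 - (w ^+ p.+1 + p.+1%:R * w ^+ p * (z - w)) =
    z * (z ^+ p - (w ^+ p + p%:R * w ^+ p.-1 * (z - w))) + p%:R * w ^+ p.-1 * (z - w) ^+ 2.
  apply: addr_ge0; first by rewrite mulr_ge0// subr_ge0.
  by rewrite mulr_ge0 ?sqr_ge0// mulr_ge0// exprn_ge0.
case: p {IH} => [|p] /=; first by rewrite !expr0 !expr1; ring.
by rewrite -!natr1 !exprS; ring.
Qed.

(* The tangent inequality for z ^ p at z = x ^ 2, since y ^ 2 - x ^ 2 >= 2 x (y - x). *)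
Lemma exprn_even_tangent_le (x y : R) (p : nat) :
  x ^+ p.*2 + p.*2%:R * x ^+ p.*2.-1 * (y - x) <= y ^+ p.*2.
Proof.
case: p => [|p]; first by rewrite !expr0 !mul0r addr0.
rewrite -!mul2n !exprM.
apply: le_trans (exprn_tangent_le p.+1 (sqr_ge0 x) (sqr_ge0 y)).
rewrite lerD2l -subr_ge0 /=.
suff -> : p.+1%:R * x ^+ 2 ^+ p * (y ^+ 2 - x ^+ 2) -
    (2 * p.+1)%:R * x ^+ (2 * p.+1).-1 * (y - x) = p.+1%:R * x ^+ 2 ^+ p * (y - x) ^+ 2.
  by rewrite mulr_ge0 ?sqr_ge0// mulr_ge0// exprn_ge0// sqr_ge0.
have -> : (2 * p.+1).-1 = (2 * p).+1 by rewrite mulnS.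
by rewrite natrM [x ^+ (2 * p).+1]exprS [x ^+ (2 * p)]exprM; ring.
Qed.

Lemma power_sum_convex F p x h :
  power_sum F p x + power_sum_diff F p x h <= power_sum F p (x + h).
Proof.
rewrite /power_sum /power_sum_diff -big_split /=; apply: ler_sum => L _.
have -> : lform L h = lform L (x + h) - lform L x by rewrite lformD; ring.
exact: exprn_even_tangent_le.
Qed.

Lemma power_sum_diffZ F p x h (a : R) :
  power_sum_diff F p x (a *: h) = a * power_sum_diff F p x h.
Proof.
rewrite /power_sum_diff mulr_sumr; apply: eq_bigr => L _.
by rewrite lformZ; ring.
Qed.

Lemma power_sum_ge0 F p x : 0 <= power_sum F p x.
Proof. by apply: sumr_ge0 => L _; rewrite -mul2n exprM exprn_ge0// sqr_ge0. Qed.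

Lemma power_sum0 F p : (0 < p)%N -> power_sum F p 0 = 0.
Proof.
case: p => // p _; rewrite /power_sum big1_seq// => L _.
by rewrite /lform mulmx0 mxE expr0n.
Qed.

(* c is the maximum of |L x| over F. *)
Lemma power_sum_max_le F p x : (0 < p)%N ->
  exists c : R, [/\ 0 <= c, forall L, L \in F -> `|lform L x| <= c &
    c ^+ p.*2 <= power_sum F p x].
Proof.
case: p => // p _; elim: F => [|L F [c [c0 Fc cV]]].
  by exists 0; split => //; rewrite /power_sum big_nil expr0n.
have V0 := power_sum_ge0 F p.+1 x.
have L0 : 0 <= lform L x ^+ p.+1.*2 by rewrite -mul2n exprM exprn_ge0// sqr_ge0.
exists (Num.max `|lform L x| c); split; first by rewrite le_max normr_ge0.
  move=> L'; rewrite inE le_max => /predU1P[->|/Fc ->]; last by rewrite orbT.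
  by rewrite lexx.
rewrite /power_sum big_cons -/(power_sum F p.+1 x).
have [_|_] := leP `|lform L x| c; first by rewrite (le_trans cV)// lerDr.
by rewrite -normrX ger0_norm// lerDl.
Qed.

Lemma power_sum_le F p x (c : R) : (forall L, L \in F -> `|lform L x| <= c) ->
  power_sum F p x <= (size F)%:R * c ^+ p.*2.
Proof.
rewrite /power_sum; elim: F => [|L F IH] Fc; first by rewrite big_nil mul0r.
rewrite big_cons /= -natr1 mulrDl mul1r addrC; apply: lerD.
  by apply: IH => L' L'F; apply: Fc; rewrite inE L'F orbT.
have Lc : `|lform L x| <= c by apply: Fc; rewrite mem_head.
apply: le_trans (ler_norm _) _; rewrite normrX.
by apply: lerXn2r; rewrite // nnegrE // (le_trans _ Lc).
Qed.

(** If c is the maximum of |L x| over [F], the power sum lies between c^(2p) and [size F] times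
    c^(2p). A contraction of the maximum thus passes to the power sum at the cost of a factor
    independent of [p]. *)
Lemma power_sum_contract F p (B : 'M[R]_n) (q : R) x : (0 < p)%N -> 0 <= q ->
  (forall c, 0 <= c -> (forall L, L \in F -> `|lform L x| <= c) ->
    forall L, L \in F -> `|lform L (B *m x)| <= q * c) ->
  power_sum F p (B *m x) <= (size F)%:R * q ^+ p.*2 * power_sum F p x.
Proof.
move=> p0 q0 Bq; have [c [c0 Fc cV]] := power_sum_max_le F x p0.
apply: le_trans (power_sum_le p (Bq c c0 Fc)) _.
by rewrite exprMn mulrA ler_wpM2l// mulr_ge0// exprn_ge0.
Qed.

Lemma power_sum_diff_le F p x h (r a : R) : 0 <= r -> 0 <= a ->
  (forall L, L \in F -> `|L| <= a) -> `|x| <= r ->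
  power_sum_diff F p x h <=
    (size F)%:R * (p.*2%:R * (n%:R * a * r) ^+ p.*2.-1 * (n%:R * a)) * `|h|.
Proof.
move=> r0 a0 Fa xr; rewrite /power_sum_diff.
elim: F Fa => [|L F IH] Fa; first by rewrite big_nil !mul0r.
rewrite big_cons /= -natr1 !mulrDl !mul1r addrC; apply: lerD.
  by apply: IH => L' L'F; apply: Fa; rewrite inE L'F orbT.
have La j : `|L ord0 j| <= a.
  by apply: le_trans (mx_norm_coord_le _ _ _) _; apply: Fa; rewrite mem_head.
apply: le_trans (ler_norm _) _; rewrite !normrM normr_nat -!mulrA.
rewrite ler_wpM2l// normrX; apply: ler_pM => //; rewrite ?exprn_ge0//.
  apply: lerXn2r; rewrite ?nnegrE// ?mulr_ge0// mulrA.
  by apply: lform_le => // j; apply: le_trans xr; exact: mx_norm_coord_le.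
by rewrite mulrA; apply: lform_le => // j; exact: mx_norm_coord_le.
Qed.

(* Both increments are bounded by the differential, by convexity. *)
Lemma power_sum_lipschitz F p (r : R) : 0 <= r ->
  exists2 C : R, 0 <= C & forall x y, `|x| <= r -> `|y| <= r ->
    `|power_sum F p y - power_sum F p x| <= C * `|y - x|.
Proof.
move=> r0; pose a := \sum_(L <- F) `|L|.
have a0 : 0 <= a by exact: sumr_ge0.
have Fa L : L \in F -> `|L| <= a.
  by move=> LF; rewrite /a (big_rem _ LF) /= lerDl sumr_ge0.
exists ((size F)%:R * (p.*2%:R * (n%:R * a * r) ^+ p.*2.-1 * (n%:R * a))).
  by rewrite !mulr_ge0// exprn_ge0// !mulr_ge0.
have H x y : `|y| <= r -> power_sum F p y - power_sum F p x <=
    (size F)%:R * (p.*2%:R * (n%:R * a * r) ^+ p.*2.-1 * (n%:R * a)) * `|y - x|.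
  move=> yr; have := power_sum_convex F p y (x - y); rewrite [y + _]addrC subrK => cv.
  have := power_sum_diff_le p (y - x) r0 a0 Fa yr; rewrite -[x - y]opprB in cv.
  have := power_sum_diffZ F p y (y - x) (-1); rewrite scaleN1r mulN1r => e.
  rewrite e in cv; lra.
by move=> x y xr yr; rewrite ler_norml lerNl opprB {1}distrC !H.
Qed.

Lemma is_derive_power_sum F p (x : R -> 'cV[R]_n) (t : R) (dx : 'cV[R]_n) :
  is_derive t (1 : R) x dx ->
  is_derive t (1 : R) (fun s => power_sum F p (x s)) (power_sum_diff F p (x t) dx).
Proof.
move=> /is_derive_mxP xdx.
rewrite /power_sum /power_sum_diff; elim: F => [|L F IH].
  rewrite big_nil; under eq_fun do rewrite big_nil; exact: is_derive_cst.
rewrite big_cons; under eq_fun do rewrite big_cons.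
apply: is_deriveD.
have lfd : is_derive t (1 : R) (fun s => lform L (x s)) (lform L dx).
  rewrite /lform mxE.
  rewrite (_ : (fun _ => _) = \sum_j (L ord0 j *: (fun s => x s j ord0))); last first.
    by apply/funext => s; rewrite mxE fct_sumE.
  by apply: is_derive_sum => j; apply: is_deriveZ.
rewrite (_ : (fun _ => _) = (fun s => lform L (x s)) ^+ p.*2); last first.
  by apply/funext => s; rewrite exprfctE.
exact: is_deriveX.
Qed.

Lemma power_sum_continuous F p : continuous (power_sum F p).
Proof.
apply: continuous_big => [|L _]; first exact: add_continuous.
have lc : continuous (lform L).
  rewrite (_ : lform L = fun x => \sum_j L ord0 j * x j ord0).
    apply: continuous_big => [|j _ x]; first exact: add_continuous.
    apply: (@continuousM _ _ (cst (L ord0 j)) (fun x : 'cV[R]_n => x j ord0)).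
      exact: cst_continuous.
    exact: coord_continuous.
  by apply/funext => x; rewrite /lform mxE.
move=> x; apply: (@continuous_comp _ _ _ (lform L) (fun z : R => z ^+ p.*2)); first exact: lc.
exact: exprn_continuous.
Qed.

Lemma power_sum_polynomial F p : is_polynomial (power_sum F p).
Proof.
exists (\sum_(L <- F) (\sum_j L ord0 j *: mpoly.mpolyX R (mpoly.mnm1 j)) ^+ p.*2) => x.
rewrite rmorph_sum; apply: eq_bigr => L _; rewrite rmorphXn; congr (_ ^+ _).
rewrite /lform mxE rmorph_sum; apply: eq_bigr => j _.
by rewrite /= mpoly.mevalZ mpoly.mevalXU.
Qed.

End power_sum.

(** * Contraction of the Euler steps *)

Section finite_net.
Variables (R : realType) (n : nat).

(** The compact closure of [S] is covered by open balls centred in [S] itself, so the points of the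
    net belong to [S] and inherit its properties. *)
Lemma bounded_finite_net (S : set 'rV[R]_n) (B e : R) : 0 < e ->
  (forall L, S L -> `|L| <= B) ->
  exists F : seq 'rV[R]_n, (forall L, L \in F -> S L) /\
    forall L, S L -> exists2 L', L' \in F & `|L - L'| < e.
Proof.
move=> e0 SB.
have close L : closure S L -> forall d, 0 < d -> exists2 L', S L' & `|L - L'| < d.
  move=> cL d d0; have [L' [SL' LL']] := cL _ (nbhsx_ballx L d d0).
  by exists L' => //; rewrite -ball_normE in LL'.
have : compact (closure S).
  apply: bounded_closed_compact; last exact: closed_closure.
  exists (B + 1); split; first exact: num_real.
  move=> M BM L /close /(_ 1 ltr01) [L' SL' LL'].
  apply: le_trans (ltW BM); rewrite -(subrK L' L).
  by rewrite (le_trans (ler_normD _ _))// addrC lerD ?SB// ltW.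
rewrite compact_cover => /(_ _ S (fun L => ball L e)) [||F FS cF].
- by move=> L _; exact: ball_open.
- move=> L /close /(_ e e0) [L' SL' LL']; exists L' => //.
  by rewrite -ball_normE /ball_ /= distrC.
exists (finmap.enum_fset F); split=> [L LF|L SL].
  by move: (FS L LF); rewrite in_setE.
have [L' FL' LL'] := cF L (subset_closure SL).
by exists L' => //; rewrite -ball_normE /ball_ /= distrC in LL'.
Qed.

End finite_net.

Section euclidean_norm.
Variables (R : realType) (n : nat).

Lemma coord_le_enorm (x : 'cV[R]_n) i : `|x i ord0| <= enorm x.
Proof.
rewrite -sqrtr_sqr /enorm ler_sqrt; last by apply: sumr_ge0 => j _; exact: sqr_ge0.
by rewrite (bigD1 i)//= lerDl sumr_ge0// => j _; exact: sqr_ge0.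
Qed.

Lemma mx_norm_le_enorm (x : 'cV[R]_n) : `|x| <= enorm x.
Proof.
apply: mx_norm_le; first exact: sqrtr_ge0.
by move=> i j; rewrite (ord1 j) coord_le_enorm.
Qed.

Lemma enorm0 : enorm (0 : 'cV[R]_n) = 0.
Proof.
by rewrite /enorm big1 ?sqrtr0// => i _; rewrite mxE expr0n.
Qed.

Lemma enorm_delta (j : 'I_n) : enorm (delta_mx j ord0 : 'cV[R]_n) = 1.
Proof.
rewrite /enorm (bigD1 j)//= mxE !eqxx expr1n big1 ?addr0 ?sqrtr1// => i ij.
by rewrite mxE (negbTE ij) expr0n.
Qed.

End euclidean_norm.

(** For small [tau] the first-order gain [lambda * tau] beats the second-order error
    [D * tau ^+ 2]. *)
Lemma discount_step (R : realType) (lambda D : R) : 0 < lambda -> 0 <= D ->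
  exists2 tau : R, 0 < tau <= 1 & expR (- (lambda * tau)) + D * tau ^+ 2 < 1.
Proof.
move=> l0 D0; have lD : 0 < lambda + D + 1 by lra.
have l1 : 0 < 1 + lambda by lra.
(* By exp(-x) <= 1 / (1 + x) and [tau <= 1], it is enough that [tau * (1 + lambda) * D < lambda];
   this choice makes the left side [lambda * D / (lambda + D + 1)]. *)
pose tau := lambda / ((lambda + D + 1) * (1 + lambda)).
have den : 0 < (lambda + D + 1) * (1 + lambda) by exact: mulr_gt0.
have tau0 : 0 < tau by exact: divr_gt0.
have tau1 : tau <= 1 by rewrite ler_pdivrMr// mul1r; nra.
exists tau; first by rewrite tau0.
have lt0 : 0 < lambda * tau by exact: mulr_gt0.
have e1 : expR (- (lambda * tau)) <= (1 + lambda * tau)^-1.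
  by rewrite expRN lef_pV2 ?posrE ?expR_gt0 ?addr_gt0// expR_ge1Dx.
apply: le_lt_trans (lerD e1 (lexx _)) _.
have key : tau * (1 + lambda) * D < lambda.
  have -> : tau * (1 + lambda) * D = lambda * D / (lambda + D + 1).
    by rewrite /tau; field; rewrite !gt_eqF.
  by rewrite ltr_pdivrMr//; nra.
have lt1 : 0 < 1 + lambda * tau by lra.
rewrite -(ltr_pM2l lt1) mulrDr mulfV ?gt_eqF// mulr1.
have : tau * (1 + lambda * tau) * D <= tau * (1 + lambda) * D.
  by rewrite ler_wpM2r// ler_wpM2l ?(ltW tau0)// lerD2l ler_piMr// ltW.
nra.
Qed.

Lemma small_even_power (R : realType) (q K : R) : 0 <= q < 1 -> 0 <= K ->
  exists2 p : nat, (0 < p)%N & K * q ^+ p.*2 < 1.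
Proof.
move=> /andP[q0 q1] K0.
have /cvgr_lt /(_ (K + 1)^-1) : (GRing.exp q : R ^nat) x @[x --> \oo] --> (0 : R).
  by apply: cvg_expr; rewrite ger0_norm.
rewrite invr_gt0 ltr_wpDl// => /(_ isT)[N _ HN].
exists N.+1 => //; have := HN N.+1.*2; rewrite /= -addnn .
move=> /(_ (leq_trans (leqnSn N) (leq_addr _ _))) qN.
have qN0 : 0 <= q ^+ (N.+1 + N.+1) by exact: exprn_ge0.
move: qN; rewrite -[(K + 1)^-1]mul1r ltr_pdivlMr ?ltr_wpDl//; nra.
Qed.

Section discounted_rows.
Variables (R : realType) (n : nat) (AA : set 'M[R]_n) (M lambda tau : R).
Hypothesis tau0 : 0 < tau.
Hypothesis gues : forall (x0 : 'cV[R]_n) (t : R) (A : R -> 'M[R]_n) (x : R -> 'cV[R]_n),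
  0 < t -> switching_function AA A -> caratheodory_solution A x0 x ->
  enorm (x t) <= M * expR (- lambda * t) * enorm x0.

Let r := expR (- (lambda * tau)).

(** Dividing by [r ^+ size s] cancels the decay that GUES gives over [size s] steps. The empty
    product contributes the coordinate forms. *)
Definition discounted_row (L : 'rV[R]_n) : Prop :=
  exists (s : seq 'M[R]_n) (i : 'I_n), (forall A, A \in s -> AA A) /\
    L = r ^- size s *: row i (\prod_(A <- s) mexp A tau).

(** GUES along the trajectory issued from the j-th basis vector bounds the j-th column of a product
    of k factors by M r^k. For k = 0 no time elapses and the entries are those of the identity,
    whence the maximum with 1. *)
Lemma discounted_row_le (L : 'rV[R]_n) : discounted_row L -> `|L| <= Num.max M 1.
Proof.
have M1 : 0 <= Num.max M 1 by rewrite le_max ler01 orbT.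
move=> [s [i [sAA ->]]]; apply: mx_norm_le => // k j; rewrite (ord1 k) !mxE normrM.
case: s sAA => [|A s] sAA.
  rewrite big_nil expr0 invr1 normr1 mul1r mxE le_max; apply/orP; right.
  by case: eqP => _; rewrite ?normr1// normr0.
have AAA : AA A by apply: sAA; rewrite mem_head.
have [B [x [sB cx _ xs]]] :=
  product_mexp_trajectory (delta_mx j ord0) (ltW tau0) AAA sAA.
have s0 : 0 < (size (A :: s))%:R * tau by rewrite mulr_gt0.
have := gues s0 sB cx; rewrite xs enorm_delta mulr1.
have -> : - lambda * ((size (A :: s))%:R * tau) = (size (A :: s))%:R * - (lambda * tau) by ring.
rewrite expRM_natl -/r => le_r.
have := le_trans (coord_le_enorm _ i) le_r; rewrite -colE mxE => le_ij.
have rs0 : 0 < r ^+ size (A :: s) by rewrite exprn_gt0// expR_gt0.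
rewrite normfV (gtr0_norm rs0) mulrC ler_pdivrMr// (le_trans le_ij)// ler_pM2r//.
by rewrite le_max lexx.

Qed.

(** The product grows by one factor on the right, whose normalization needs one more 1 / r. This is
    the source of the contraction. *)
Lemma discounted_row_mul (L : 'rV[R]_n) (A : 'M[R]_n) : AA A -> discounted_row L ->
  exists2 L', discounted_row L' & L *m mexp A tau = r *: L'.
Proof.
move=> AAA [s [i [sAA ->]]].
exists (r ^- (size s).+1 *: row i (\prod_(B <- rcons s A) mexp B tau)).
  exists (rcons s A), i; rewrite size_rcons; split => // B.
  by rewrite mem_rcons inE => /predU1P[->//|]; exact: sAA.
rewrite scalerA exprS invfM mulVKf ?gt_eqF ?expR_gt0//.
rewrite -scalemxAl; congr (_ *: _); rewrite -row_mul; congr row.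
by rewrite -cats1 big_cat /= big_seq1.
Qed.

Lemma discounted_row_delta (i : 'I_n) : discounted_row (row i 1%:M).
Proof. by exists [::], i; split => //; rewrite big_nil expr0 invr1 scale1r. Qed.

End discounted_rows.

Section contraction.
Variables (R : realType) (n : nat) (AA : set 'M[R]_n) (K : R).
Hypotheses (AAK : forall A, AA A -> forall i j, `|A i j| <= K) (K0 : 0 <= K).

(** A finite net replaces the supremum over all discounted rows, at the cost of a factor 1 / (1 -
    theta); the strict contraction by [sigma] has room to absorb it. *)
Lemma GUES_euler_contraction : GUES AA ->
  exists (F : seq 'rV[R]_n) (tau q : R), [/\ 0 < tau, 0 <= q < 1,
    forall x c, (forall L, L \in F -> `|lform L x| <= c) -> 0 <= c -> `|x| <= 2 * c &
    forall A x c, AA A -> 0 <= c -> (forall L, L \in F -> `|lform L x| <= c) ->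
      forall L, L \in F -> `|lform L ((1%:M + tau *: A) *m x)| <= q * c].
Proof.
move=> [M [lambda [M0 lambda0 gues]]].
pose M1 := Num.max M 1; have M10 : 0 <= M1 by rewrite le_max ler01 orbT.
pose b := n%:R * K; have b0 : 0 <= b by exact: mulr_ge0.
pose C := b ^+ 2 * expR b; have C0 : 0 <= C by rewrite mulr_ge0 ?expR_ge0// exprn_ge0.
(* [D * tau ^+ 2] bounds, relative to [|x|], a discounted row applied to the remainder (exp(tau A) -
   I - tau A) x. *)
pose D := n%:R * M1 * (n%:R * C); have D0 : 0 <= D by rewrite !mulr_ge0.
have [tau /andP[tau0 tau1]] := discount_step lambda0 D0.
set r := expR (- (lambda * tau)); set sigma := r + _ => sigma1.
have r0 : 0 < r by exact: expR_gt0.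
have Dtau0 : 0 <= D * tau ^+ 2 by rewrite mulr_ge0// exprn_ge0// ltW.
have sigma0 : 0 < sigma by exact: ltr_pwDl.
(* Then 1 - theta = (1 + sigma) / 2 exceeds both [sigma] and 1/2: hence a ratio below 1 and the
   constant 2 in the norm bound. *)
pose theta := (1 - sigma) / 2.
have theta0 : 0 < theta by rewrite divr_gt0// subr_gt0.
have n1 : 0 < n%:R + 1 :> R by rewrite ltr_wpDl.
have row_le := discounted_row_le tau0 gues.
(* The mesh [theta / (n + 1)] is finer than [theta] because |L x| is bounded by n |L| |x| in the
   maximum norms. *)
have [F [Frow Fnet]] := bounded_finite_net (divr_gt0 theta0 n1) row_le.
have approx x c : (forall L, L \in F -> `|lform L x| <= c) ->
    forall L, discounted_row AA lambda tau L -> `|lform L x| <= c + theta * `|x|.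
  move=> Fc L /Fnet [L' /Fc L'c LL'].
  have -> : lform L x = lform L' x + lform (L - L') x.
    by rewrite /lform mulmxBl !mxE; ring.
  apply: le_trans (ler_normD _ _) _; apply: lerD => //.
  apply: (@le_trans _ _ (n%:R * (theta / (n%:R + 1)) * `|x|)).
    apply: lform_le => j; last exact: mx_norm_coord_le.
    by apply: le_trans (mx_norm_coord_le _ _ _) (ltW LL').
  rewrite ler_wpM2r// mulrCA ler_piMr// ?ltW//.
  by rewrite ltr_pdivrMr// mul1r ltrDl.
have norm_le x c : (forall L, L \in F -> `|lform L x| <= c) -> 0 <= c ->
    `|x| <= c + theta * `|x|.
  move=> Fc c0; apply: mx_norm_le.
    by rewrite addr_ge0// mulr_ge0// ltW.
  (* The coordinates of [x] are values of discounted rows, so the net controls them. *)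
  move=> i j; rewrite (ord1 j).
  have := approx x c Fc _ (discounted_row_delta AA lambda tau i).
  by rewrite /lform -row_mul mul1mx mxE.
have theta12 : theta <= 2^-1 by rewrite /theta; lra.
have th1 : 0 < 1 - theta by lra.
exists F, tau, (sigma / (1 - theta)); split => //.
- rewrite divr_ge0 ?ltW//= ltr_pdivrMr// mul1r /theta; lra.
- move=> x c Fc c0; have := norm_le x c Fc c0.
  have : 0 <= `|x| by []. nra.
- move=> A x c AAA c0 Fc L LF.
  have xle := norm_le x c Fc c0.
  have xc : `|x| <= c / (1 - theta) by rewrite ler_pdivlMr//; lra.
  (* The Euler step is the exponential step, which contracts by [r], minus the second-order
     remainder. *)
  have -> : lform L ((1%:M + tau *: A) *m x) =
      lform (L *m mexp A tau) x - lform L ((mexp A tau - 1%:M - tau *: A) *m x).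
    rewrite lform_mulmx -lformN -lformD -mulNmx -mulmxDl.
    by rewrite opprB addrCA subKr addrC.
  apply: le_trans (ler_normB _ _) _.
  have [L' L'row ->] := discounted_row_mul AAA (Frow L LF).
  have e1 : `|lform (r *: L') x| <= r * (c / (1 - theta)).
    rewrite /lform -scalemxAl mxE normrM (gtr0_norm r0) ler_wpM2l ?(ltW r0)//.
    apply: le_trans (approx x c Fc L' L'row) _.
    have -> : c / (1 - theta) = c + theta * (c / (1 - theta)).
      by field; rewrite gt_eqF.
    by rewrite lerD2l ler_wpM2l// ltW.
  have e2 : `|lform L ((mexp A tau - 1%:M - tau *: A) *m x)| <=
      D * tau ^+ 2 * (c / (1 - theta)).
    apply: (@le_trans _ _ (D * tau ^+ 2 * `|x|)); last by rewrite ler_wpM2l.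
    rewrite (_ : D * tau ^+ 2 * `|x| = n%:R * M1 * (n%:R * (C * tau ^+ 2) * `|x|)).
      apply: lform_le => j.
        by apply: le_trans (mx_norm_coord_le _ _ _) _; exact: row_le (Frow L LF).
      apply: mulmx_coord_le => k; last exact: mx_norm_coord_le.
      by apply: mexp_second_order; [exact: AAK|rewrite (ltW tau0)].
    by rewrite /D; ring.
  apply: le_trans (lerD e1 e2) _.
  by rewrite -mulrDl -/sigma mulrAC -mulrA.
Qed.

End contraction.

(** * The polynomial Lyapunov function *)

Section lyapunov.
Variables (R : realType) (n : nat) (AA : set 'M[R]_n).

Lemma GUES_power_sum (K : R) : (forall A, AA A -> forall i j, `|A i j| <= K) -> 0 <= K ->
  GUES AA -> exists (F : seq 'rV[R]_n) (p : nat) (c1 c2 : R), [/\ (0 < p)%N, 0 < c1,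
    forall x, x != 0 -> 0 < power_sum F p x,
    forall A x, AA A -> power_sum_diff F p x (A *m x) <= - c1 * power_sum F p x &
    forall A x, AA A -> - c2 * power_sum F p x <= power_sum_diff F p x (A *m x)].
Proof.
move=> AAK K0 /(GUES_euler_contraction AAK K0)[F [tau [q [tau0 /andP[q0 q1] Fnorm Fq]]]].
have [p p0 Np] : exists2 p : nat, (0 < p)%N & (size F)%:R * q ^+ p.*2 < 1.
  by apply: small_even_power; rewrite ?q0.
set rho := _ * _ in Np.
pose a := \sum_(L <- F) `|L|.
have Fa L : L \in F -> `|L| <= a.
  by move=> LF; rewrite /a (big_rem _ LF) /= lerDl sumr_ge0.
have a0 : 0 <= a by exact: sumr_ge0.
(* Crude growth factor of the backward step I - tau A: the forms have norm at most [a], the step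
   multiplies the norm by at most [1 + tau * (n%:R * K)], and [|x| <= 2 * c]. *)
pose q' := n%:R * a * (2 * (1 + tau * (n%:R * K))).
have q'0 : 0 <= q' by rewrite !mulr_ge0// addr_ge0// !mulr_ge0// ltW.
pose rho' := (size F)%:R * q' ^+ p.*2.
exists F, p, ((1 - rho) / tau), ((rho' - 1) / tau); split => //.
- by rewrite divr_gt0// subr_gt0.
- move=> x x0; have [c [c0 Fc cV]] := power_sum_max_le F x p0.
  apply: lt_le_trans cV; rewrite exprn_gt0// lt_neqAle c0 andbT.
  apply: contra x0 => /eqP c_eq0; rewrite -normr_le0.
  by have := Fnorm x c Fc c0; rewrite -c_eq0 mulr0.
- move=> A x AAA.
  have := power_sum_convex F p x (tau *: (A *m x)); rewrite power_sum_diffZ.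
  have -> : x + tau *: (A *m x) = (1%:M + tau *: A) *m x.
    by rewrite mulmxDl mul1mx -scalemxAl.
  move=> /le_trans /(_ (power_sum_contract p0 q0 (fun c c0 Fc => Fq A x c AAA c0 Fc))).
  rewrite -/rho => h.
  rewrite -(ler_pM2l tau0).
  have -> : tau * (- ((1 - rho) / tau) * power_sum F p x) = (rho - 1) * power_sum F p x.
    by field; rewrite gt_eqF.
  lra.
- move=> A x AAA.
  (* With the increment reversed, an upper bound on V(x - tau A x) becomes a lower bound on the
     differential along [A *m x]. *)
  have := power_sum_convex F p x ((- tau) *: (A *m x)); rewrite power_sum_diffZ.
  have -> : x + (- tau) *: (A *m x) = (1%:M - tau *: A) *m x.
    by rewrite mulmxBl mul1mx -scalemxAl scaleNr.
  have ct c : 0 <= c -> (forall L, L \in F -> `|lform L x| <= c) ->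
      forall L, L \in F -> `|lform L ((1%:M - tau *: A) *m x)| <= q' * c.
    move=> c0 Fc L LF.
    rewrite (_ : q' * c = n%:R * a * ((1 + tau * (n%:R * K)) * (2 * c))); last first.
      by rewrite /q'; ring.
    apply: lform_le => j.
      by apply: le_trans (mx_norm_coord_le _ _ _) (Fa L LF).
    have xc := Fnorm x c Fc c0.
    rewrite mulmxBl mul1mx -scalemxAl !mxE.
    apply: le_trans (ler_normB _ _) _; rewrite mulrDl mul1r; apply: lerD.
      exact: le_trans (mx_norm_coord_le _ _ _) xc.
    rewrite normrM (gtr0_norm tau0) -mulrA ler_wpM2l ?(ltW tau0)//.
    have := @mulmx_coord_le _ _ _ _ A x K (2 * c) j ord0 (fun k => AAK A AAA j k).
    rewrite mxE; apply => k.
    exact: le_trans (mx_norm_coord_le _ _ _) xc.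
  move=> /le_trans /(_ (power_sum_contract p0 q'0 ct)); rewrite -/rho' => h.
  rewrite -(ler_pM2l tau0).
  have -> : tau * (- ((rho' - 1) / tau) * power_sum F p x) = (1 - rho') * power_sum F p x.
    by field; rewrite gt_eqF.
  lra.
Qed.

Lemma GUES_norm_bounded : GUES AA -> exists2 M : R, 0 <= M &
  forall (x0 : 'cV[R]_n) (A : R -> 'M[R]_n) (x : R -> 'cV[R]_n) (t : R),
    0 <= t -> switching_function AA A -> caratheodory_solution A x0 x ->
    `|x t| <= M * enorm x0.
Proof.
(* [M] covers positive times, 1 covers time 0. *)
move=> [M [lambda [M0 lambda0 gues]]]; exists (Num.max M 1); first by rewrite le_max ler01 orbT.
move=> x0 A x t t0 sA cx; apply: le_trans (mx_norm_le_enorm _) _.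
have e0 : 0 <= enorm x0 by exact: sqrtr_ge0.
move: t0; rewrite le_eqVlt => /predU1P[<-|t0].
  by have [-> _ _] := cx; rewrite ler_peMl// le_max lexx orbT.
apply: le_trans (gues _ _ _ _ t0 sA cx) _; rewrite ler_wpM2r//.
apply: (@le_trans _ _ M); last by rewrite le_max lexx.
by rewrite ler_piMr ?(ltW M0)// -expR0 ler_expR mulNr oppr_le0 mulr_ge0// ltW.
Qed.

Lemma abs_continuous_subitv (W : normedModType R) (a b c d : R) (f : R -> W) :
  a <= c -> d <= b -> abs_continuous a b f -> abs_continuous c d f.
Proof.
move=> ac db fac e e0; have [r r0 fr] := fac e e0; exists r => // N u v uv.
apply: fr => i; have [cu [uv_i vd]] := uv i.
by split; [exact: le_trans cu|split => //; exact: le_trans db].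
Qed.

(** Along a trajectory V is bounded below by exp(-c2 t) V(x0), hence stays positive, and the decay
    at rate [c1] from a positive value is strict. *)
Lemma power_sum_lyapunov F p (c1 c2 : R) : GUES AA -> (0 < p)%N -> 0 < c1 ->
  (forall x, x != 0 -> 0 < power_sum F p x) ->
  (forall A x, AA A -> power_sum_diff F p x (A *m x) <= - c1 * power_sum F p x) ->
  (forall A x, AA A -> - c2 * power_sum F p x <= power_sum_diff F p x (A *m x)) ->
  common_lyapunov AA (power_sum F p).
Proof.
move=> gues p0 c10 Vpos Vle Vge; split => //.
- exact: power_sum_continuous.
- exact: power_sum_ge0.
- exact: power_sum0.
move=> A x0 x sA cx [t1 t10 xt1] s t s0 st.
have [M M0 xM] := GUES_norm_bounded gues.
(* GUES forces a trajectory issued from the origin to stay there, so a nonconstant one starts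
   elsewhere. *)
have x0_neq0 : x0 != 0.
  apply: contra xt1 => /eqP x00; rewrite x00 -normr_le0.
  by have := xM x0 A x t1 t10 sA cx; rewrite x00 enorm0 mulr0.
(* The whole trajectory remains in this ball, on which V is Lipschitz; so V along it is bounded and
   absolutely continuous. *)
pose rho := M * enorm x0.
have rho0 : 0 <= rho by apply: mulr_ge0 => //; exact: sqrtr_ge0.
have xrho u : 0 <= u -> `|x u| <= rho by move=> u0; exact: xM u0 sA cx.
have [C C0 VC] := power_sum_lipschitz F p rho0.
have [xx0 xac dx] := cx.
pose f u := power_sum F p (x u).
have fB u : 0 <= u -> `|f u| <= C * rho.
  move=> u0; have := VC 0 (x u); rewrite normr0 (power_sum0 _ p0) !subr0.
  by move=> /(_ rho0 (xrho u u0)) /le_trans; apply; rewrite ler_wpM2l// xrho.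
have fac a b : 0 <= a -> a < b -> abs_continuous a b f.
  move=> a0 ab; apply: (@abs_continuous_dominated _ _ _ a b C 0 x f) => //.
    move=> u v au uv vb; rewrite mul0r addr0; apply: VC; apply: xrho.
      exact: le_trans au.
    exact: le_trans (le_trans a0 au) uv.
  apply: (@abs_continuous_subitv _ 0 b) => //.
  exact: xac (le_lt_trans a0 ab).
have FF := ae_filter_ringOfSetsType (@lebesgue_measure R).
have dec a b : 0 <= a -> a < b -> f b <= expR (- c1 * (b - a)) * f a.
  move=> a0 ab; apply: (@abs_continuous_exp_comparison _ _ _ _ _ (C * rho)) => //.
  - exact: ltW.
  - exact: fac.
  - by move=> u /andP[au _]; apply: fB; exact: le_trans au.
  - apply: (@filterS _ _ FF) dx => u dxu au ub.
    have u0 : 0 < u by exact: le_lt_trans au.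
    exists (power_sum_diff F p (x u) (A u *m x u)).
      by apply: Vle; apply sA; exact: ltW.
    by apply: is_derive_power_sum; exact: dxu.
(* The lower bound is the comparison lemma applied to [- f]. *)
have inc b : 0 < b -> expR (- c2 * b) * f 0 <= f b.
  move=> b0; rewrite -lerN2 -mulrN.
  have := @abs_continuous_exp_comparison _ (\- f) 0 b (- c2) (C * rho).
  rewrite subr0; apply => //.
  - exact: ltW.
  - apply: (@abs_continuous_dominated _ _ _ 0 b 1 0 f) => //; last exact: fac.
    by move=> u v _ _ _; rewrite mul0r addr0 mul1r -opprD normrN.
  - by move=> u /andP[u0 _]; rewrite normrN; exact: fB.
  - apply: (@filterS _ _ FF) dx => u dxu u0 ub.
    exists (- power_sum_diff F p (x u) (A u *m x u)).
      by rewrite /= mulrN lerN2; apply: Vge; apply sA; exact: ltW.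
    by apply: is_deriveN; apply: is_derive_power_sum; exact: dxu.
have fs : 0 < f s.
  move: s0; rewrite le_eqVlt => /predU1P[<-|s0]; first by rewrite /f xx0 Vpos.
  by apply: lt_le_trans (inc s s0); rewrite mulr_gt0 ?expR_gt0// /f xx0 Vpos.
apply: le_lt_trans (dec s t s0 st) _.
by rewrite gtr_pMl// -expR0 ltr_expR mulNr oppr_lt0 mulr_gt0// subr_gt0.
Qed.

End lyapunov.

Theorem theorem1 (R : realType) (n : nat) (hn : (1 <= n)%N)
    (AA : set 'M[R]_n) (hAA : compact AA) (hgues : GUES AA) :
  exists V : 'cV[R]_n -> R, common_lyapunov AA V /\ is_polynomial V.
Proof.
have [K0 [_ AAK0]] := compact_bounded hAA.
(* Boundedness provides a bound by every number above [K0]; the maximum ensures nonnegativity. *)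
pose K := Num.max 0 (K0 + 1).
have AAK A : AA A -> forall i j, `|A i j| <= K.
  move=> AAA i j; apply: le_trans (mx_norm_coord_le A i j) _.
  have h : `|A| <= K0 + 1 by apply: AAK0 => //; rewrite ltrDl.
  by rewrite le_max h orbT.
have [|F [p [c1 [c2 [p0 c10 Vpos Vle Vge]]]]] := GUES_power_sum AAK _ hgues.
  by rewrite le_max lexx.
exists (power_sum F p); split; last exact: power_sum_polynomial.
exact: power_sum_lyapunov hgues p0 c10 Vpos Vle Vge.
Qed.
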